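(* Let $(X,\Sigma_X,\mu)$ and $(Y,\Sigma_Y,\nu)$ be measure spaces. If $\mu$ and $\nu$ are two s-finite measures, then the pair $(\mu,\nu)$ is abelian.
   Context: A measure on a measurable space $(\Omega,\Sigma_\Omega)$ is s-finite if it can be expressed as a countable sum of finite measures, all defined on $(\Omega,\Sigma_\Omega)$. $\Sigma_X\otimes\Sigma_Y$ denotes the $\sigma$-algebra on $X\times Y$ generated by the measurable rectangles $E\times F$ with $E\in\Sigma_X$, $F\in\Sigma_Y$. For $A\subseteq X\times Y$, write $A^y=\{x\in X\mid (x,y)\in A\}$ and $A_x=\{y\in Y\mid (x,y)\in A\}$. The pair $(\mu,\nu)$ is called abelian if for every $A\in\Sigma_X\otimes\Sigma_Y$: (i) $y\mapsto\mu(A^y)$ is $\Sigma_Y$-measurable; (ii) $x\mapsto\nu(A_x)$ is $\Sigma_X$-measurable; (iii) $\int_Y\mu(A^y)\,d\nu(y)=\int_X\nu(A_x)\,d\mu(x)$ (as elements of $[0,+\infty]$). *)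

(* Defs.v *)
From mathcomp Require Import all_boot all_order all_algebra.
From mathcomp Require Import all_classical all_reals all_analysis.
(* not reexported by all_analysis: Borel sigma-algebra on [\bar R] *)
From mathcomp Require Import measurable_realfun.

Set Implicit Arguments.
Unset Strict Implicit.
Unset Printing Implicit Defensive.

Local Open Scope classical_set_scope.
Local Open Scope ring_scope.
Local Open Scope ereal_scope.

(* The canonical sigma-algebra on [X * Y] is the one generated by measurable
   rectangles ([measurable_prod_measurableType]).  The section A^y is
   [ysection A y] and the section A_x is [xsection A x]. *)
Definition abelian_pair (d1 d2 : measure_display) (X : measurableType d1)
    (Y : measurableType d2) (R : realType)
    (mu : {measure set X -> \bar R}) (nu : {measure set Y -> \bar R}) : Prop :=
  forall A : set (X * Y), measurable A ->
    [/\ measurable_fun [set: Y] (fun y => mu (ysection A y)),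
        measurable_fun [set: X] (fun x => nu (xsection A x)) &
        \int[nu]_(y in [set: Y]) mu (ysection A y) =
        \int[mu]_(x in [set: X]) nu (xsection A x)].

(* Main.v *)
(* Sections of a measurable set have measurable measure for a finite measure,
   hence, summing a series, for an s-finite one; the equality of the two
   integrals is Tonelli's theorem applied to the indicator function of A. *)
Require Import Defs.
From HB Require Import structures.
From mathcomp Require Import all_boot all_order all_algebra.
From mathcomp Require Import all_classical all_reals all_analysis.
From mathcomp Require Import measurable_realfun.

Local Open Scope classical_set_scope.
Local Open Scope ring_scope.
Local Open Scope ereal_scope.

Lemma measurable_fun_xsection_sfinite (R : realType) (d1 d2 : measure_display)
    (X : measurableType d1) (Y : measurableType d2)
    (nu : {sfinite_measure set Y -> \bar R}) (A : set (X * Y)) :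
  measurable A -> measurable_fun [set: X] (fun x => nu (xsection A x)).
Proof.
move=> mA.
rewrite [X in measurable_fun _ X](_ : _ =
    fun x => \sum_(n <oo) sfinite_measure_seq nu n (xsection A x)); last first.
  apply/funext => x.
  (* The decomposition of [nu] into finite measures is an equality on measurable sets, so the
     section must first be shown measurable. *)
  by rewrite sfinite_measure_seqP//; exact: measurable_xsection.
apply: ge0_emeasurable_sum => [//|n _].
exact: (@measurable_fun_xsection _ _ _ _ _ (sfinite_measure_seq nu n)).
Qed.

Lemma measurable_fun_ysection_sfinite (R : realType) (d1 d2 : measure_display)
    (X : measurableType d1) (Y : measurableType d2)
    (mu : {sfinite_measure set X -> \bar R}) (A : set (X * Y)) :
  measurable A -> measurable_fun [set: Y] (fun y => mu (ysection A y)).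
Proof.
move=> mA.
rewrite [X in measurable_fun _ X](_ : _ =
    fun y => \sum_(n <oo) sfinite_measure_seq mu n (ysection A y)); last first.
  apply/funext => y.
  by rewrite sfinite_measure_seqP//; exact: measurable_ysection.
apply: ge0_emeasurable_sum => [//|n _].
exact: (@measurable_fun_ysection _ _ _ _ _ (sfinite_measure_seq mu n)).
Qed.

Theorem theorem2p12 (R : realType) (d1 d2 : measure_display)
    (X : measurableType d1) (Y : measurableType d2)
    (mu : {measure set X -> \bar R}) (nu : {measure set Y -> \bar R})
    (hmu : sfinite_measure mu) (hnu : sfinite_measure nu) :
  abelian_pair mu nu.
Proof.
move=> A mA.
(* [mu'] and [nu'] are [mu] and [nu] bundled with their s-finiteness; they are convertible to the
   originals, so results about them close goals about [mu] and [nu]. *)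
pose mu' : {sfinite_measure set X -> \bar R} :=
  HB.pack (Measure.sort mu) (isSFinite.Build _ _ _ mu hmu).
pose nu' : {sfinite_measure set Y -> \bar R} :=
  HB.pack (Measure.sort nu) (isSFinite.Build _ _ _ nu hnu).
split.
- exact: (measurable_fun_ysection_sfinite _ _ _ _ _ mu').
- exact: (measurable_fun_xsection_sfinite _ _ _ _ _ nu').
(* The measure of a section is the integral of its indicator, which is the indicator of [A] with one
   coordinate frozen. *)
transitivity (\int[nu']_y \int[mu']_x (\1_A (x, y))%:E).
  apply: eq_integral => y _.
  transitivity (\int[mu']_x (\1_(ysection A y) x)%:E).
    by rewrite integral_indic ?setIT//; exact: measurable_ysection.
  by apply: eq_integral => x _; rewrite !indicE mem_ysection.
(* Read from right to left, the exchange puts the integral in [x] outside; nonnegativity and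
   measurability of the indicator remain as side goals. *)
rewrite -(sfinite_Fubini mu' nu' (fun z => (\1_A z)%:E)).
- apply: eq_integral => x _.
  transitivity (\int[nu']_y (\1_(xsection A x) y)%:E).
    by apply: eq_integral => y _; rewrite !indicE mem_xsection.
  by rewrite integral_indic ?setIT//; exact: measurable_xsection.
- by move=> z; rewrite lee_fin.
- by apply/measurable_EFinP; exact: measurable_indic.
Qed.
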